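(* For every $k\ge 2$, the ideal $I_k\subset R_k$ is radical.
   Context: $\mathbb F$ is a field of characteristic $\neq 2$. For $k\ge 2$, $R_k$ is the polynomial ring over $\mathbb F$ in the $3k$ variables $v_{i,c}$ ($1\le i\le k$, $c=1,2,3$), and $\overline v_i=(v_{i,1},v_{i,2},v_{i,3})\in R_k^3$. Let $S=\mathrm{diag}(-1,-1,1)$ and let $a\times b=(a_2b_3-a_3b_2,\;a_3b_1-a_1b_3,\;a_1b_2-a_2b_1)$ be the cross product. Define recursively $\overline w_2=\overline v_1\times\overline v_2$ and $\overline w_j=S(\overline w_{j-1})\times\overline v_j$ for $j\ge 3$. $I_k\subset R_k$ is the ideal generated by the three components of $\overline w_k$. *)

(* Defs.v *)
From HB Require Import structures.
From mathcomp Require Import all_boot all_order all_algebra.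
From mathcomp Require Import mpoly.
Set Implicit Arguments.
Unset Strict Implicit.
Unset Printing Implicit Defensive.
Import GRing.Theory.
Local Open Scope ring_scope.

Definition ideal_gen (R : comNzRingType) (I : finType) (g : I -> R) : R -> Prop :=
  fun f => exists a : I -> R, f = \sum_(i : I) a i * g i.

Definition is_radical (R : comNzRingType) (J : R -> Prop) : Prop :=
  forall (f : R) (n : nat), J (f ^+ n) -> J f.

(* The components 1, 2, 3 of a vector are the entries of index 0, 1, 2. *)
Definition cross (R : comNzRingType) (a b : 'cV[R]_3) : 'cV[R]_3 :=
  let x (u : 'cV[R]_3) (c : nat) := u (inord c) 0 in
  \col_(c < 3) nth 0
    [:: x a 1%N * x b 2%N - x a 2%N * x b 1%N;
        x a 2%N * x b 0%N - x a 0%N * x b 2%N;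
        x a 0%N * x b 1%N - x a 1%N * x b 0%N] c.

Definition Smx (R : comNzRingType) : 'M[R]_3 :=
  diag_mx (\row_(c < 3) nth 0 [:: -1; -1; 1] c).

(* The bijection mxvec_index : 'I_k -> 'I_3 -> 'I_(k * 3) numbers the variables. *)
Definition Rk (F : fieldType) (k : nat) : comNzRingType := {mpoly F[k * 3]}.

(* The index i is 1-based, as in v_1, ..., v_k; it is only meaningful for
   1 <= i <= k. *)
Definition vvec (F : fieldType) (k i : nat) : 'cV[Rk F k]_3 :=
  \col_(c < 3) if insub i.-1 is Some i' then 'X_(mxvec_index (i' : 'I_k) c)
               else 0.

(* wvec v j is w_j for j >= 2; the values at j < 2 are irrelevant. *)
Fixpoint wvec (R : comNzRingType) (v : nat -> 'cV[R]_3) (j : nat) : 'cV[R]_3 :=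
  if j is j'.+1 then
    if (j <= 2)%N then cross (v 1%N) (v 2%N)
    else cross (Smx R *m wvec v j') (v j)
  else 0.

Definition Ik (F : fieldType) (k : nat) : Rk F k -> Prop :=
  ideal_gen (fun c : 'I_3 => wvec (vvec F k) k c 0).

Arguments Ik : clear implicits.

(* Main.v *)
Require Import Defs.
From mathcomp Require Import all_boot all_order all_algebra.
From mathcomp Require Import all_fingroup.
From mathcomp Require Import mpoly ring zify.
Set Implicit Arguments.
Unset Strict Implicit.
Unset Printing Implicit Defensive.
Import Order.TTheory GRing.Theory.
Local Open Scope ring_scope.

(** Since S is a rotation, it can be pushed through cross products: up to signs
    the components of w_j are those of the iterated cross product
    a_0 = t_0, a_i = a_(i-1) x t_i, where t_i is the i-th vector of variables
    (counted from 0) with some signs changed, and changing the sign of variables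
    is an automorphism of the ring.  So it is enough to show that the ideal
    (a_j) is radical for j >= 1 when the t_i are vectors of distinct variables.
    This goes by induction on j.

    Let j >= 2, w = a_(j-2), y = t_(j-1), x = t_j and u = a_(j-1) = w x y.
    Geometrically, u x x = 0 means that u = 0 or that x is parallel to u, and in
    the second case x is orthogonal to both w and y.  With p = w.x and q = y.x
    this suggests that (u x x) is the intersection of (u) and (p, q), which gives
    the result: (u) is radical by induction and (p, q) is radical by inspection of
    leading monomials.  For the intersection, take f = c.u in (p, q); modulo
    (p, q) one has x_i f = (c.x) u_i, so that c.x lies in (p, q) as soon as some
    u_i is a nonzerodivisor modulo (p, q); then c - alpha w - beta y is
    orthogonal to x for some alpha and beta, hence of the form x x e because x
    consists of variables, and f = c.u is a combination of the components of
    u x x (lemma [crs_radical_step]).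

    What remains is to see that (p, q) is radical and that some u_i is regular
    modulo it.  Both hold if the leading monomials of p, q and u_i are pairwise
    coprime and those of p and q are squarefree ([ideal2_radical],
    [ideal2_nzd]): coprime leading monomials make p, q a Groebner basis.  For
    the degree-lexicographic order in which the block y comes first, then x, then
    t_(j-2), t_(j-3), ..., t_0, with a cyclically rotating order inside the
    blocks, the leading monomials can be followed through the recursion
    ([lead_shape_crs]) and have these properties ([crs_radical_ordered]).  The
    order depends on j, hence the induction hypothesis is about all numberings
    of the variables.

    For j = 1 the ideal is generated by the 2 x 2 minors of a generic 2 x 3
    matrix; it is the kernel of the substitution x_i := u_i x_c, again because
    its leading monomials are the expected ones ([crs_vars_radical]). *)

(** * Three-dimensional vectors and cross products *)

Lemma I3_case (c i : 'I_3) : [\/ i = c, i = c + 1 | i = c + 2%:R].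
Proof.
have: [|| i == c, i == c + 1 | i == c + 2%:R].
  by case: c i => [[|[|[|c]]] Hc] [[|[|[|i]]] Hi].
by case/or3P=> /eqP; [constructor 1|constructor 2|constructor 3].
Qed.

Lemma I3_addE (c : 'I_3) :
  (c + 1 + 1 = c + 2%:R) * (c + 1 + 2%:R = c)
  * (c + 2%:R + 1 = c) * (c + 2%:R + 2%:R = c + 1).
Proof.
by do !split; apply/val_inj; case: c => [[|[|[|c]]] Hc].
Qed.

Lemma sum_I3 (V : nmodType) (F : 'I_3 -> V) (c : 'I_3) :
  \sum_i F i = F c + F (c + 1) + F (c + 2%:R).
Proof.
rewrite (bigD1 c) //= (bigD1 (c + 1)) /=; last first.
  by case: c => [[|[|[|c]]] Hc].
rewrite (bigD1 (c + 2%:R)) /=; last by case: c => [[|[|[|c]]] Hc].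
rewrite big1 ?addr0 ?addrA // => i.
by case: (I3_case c i) => ->; rewrite ?eqxx ?andbF //; case: c => [[|[|[|c]]] Hc].
Qed.

Section CrossAlgebra.
Variable R : comNzRingType.
Implicit Types (u v w x y : 'I_3 -> R) (f g p q : R).

(** The indices live in the cyclic group 'I_3, which makes the formula uniform
    in the component. *)
Definition crs u v : 'I_3 -> R :=
  fun c => u (c + 1) * v (c + 2%:R) - u (c + 2%:R) * v (c + 1).

Definition dot u v : R := \sum_i u i * v i.

Definition ideal2 p q f := exists a b, f = a * p + b * q.

Definition ideal (J : R -> Prop) :=
  [/\ J 0, forall f g, J f -> J g -> J (f + g) & forall c f, J f -> J (c * f)].

Lemma ideal_gen_ideal (I : finType) (g : I -> R) : ideal (ideal_gen g).
Proof.
split.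
- by exists (fun=> 0); rewrite big1 // => i _; rewrite mul0r.
- move=> _ _ [a ->] [b ->]; exists (fun i => a i + b i).
  by rewrite -big_split; apply: eq_bigr => i _; rewrite mulrDl.
- move=> c _ [a ->]; exists (fun i => c * a i).
  by rewrite mulr_sumr; apply: eq_bigr => i _; rewrite mulrA.
Qed.

Lemma ideal_gen_incl (I : finType) (g : I -> R) (J : R -> Prop) :
  ideal J -> (forall i, J (g i)) -> forall f, ideal_gen g f -> J f.
Proof.
case=> J0 JD JM Jg f [a ->].
by elim/big_ind: _ => // i _; apply/JM/Jg.
Qed.

Lemma mem_ideal_gen (I : finType) (g : I -> R) i : ideal_gen g (g i).
Proof.
exists (fun k => (k == i)%:R); rewrite (bigD1 i) //= eqxx mul1r.
by rewrite big1 ?addr0 // => j /negPf ->; rewrite mul0r.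
Qed.

Lemma ideal2_ideal p q : ideal (ideal2 p q).
Proof.
split; first by exists 0, 0; rewrite !mul0r addr0.
  move=> _ _ [a [b ->]] [c [d ->]]; exists (a + c), (b + d).
  by rewrite !mulrDl addrACA.
by move=> c _ [a [b ->]]; exists (c * a), (c * b); rewrite mulrDr !mulrA.
Qed.

Lemma is_radical_signed (I : finType) (g g' : I -> R) (b : I -> bool) :
  (forall i, g' i = (-1) ^+ b i * g i) ->
  is_radical (ideal_gen g) -> is_radical (ideal_gen g').
Proof.
move=> gE rad f n fn.
have gg' h : ideal_gen g h -> ideal_gen g' h.
  apply: ideal_gen_incl => [|i]; first exact: ideal_gen_ideal.
  rewrite -[g i](signrMK (b i)) -gE.
  have [_ _ JM] := ideal_gen_ideal g'; apply: JM; exact: mem_ideal_gen.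
apply/gg'/(rad f n); move: fn; apply: ideal_gen_incl => [|i].
  exact: ideal_gen_ideal.
rewrite gE; have [_ _ JM] := ideal_gen_ideal g; apply: JM; exact: mem_ideal_gen.
Qed.

Lemma is_radical_eq (I : finType) (g g' : I -> R) : g =1 g' ->
  is_radical (ideal_gen g) -> is_radical (ideal_gen g').
Proof.
move=> gE; apply: (is_radical_signed (b := fun=> false)) => i.
by rewrite mul1r gE.
Qed.

(** The map [phi] carries a power of f into the image ideal, and [psi] pulls back
    the coefficients of the representation found there. *)
Lemma is_radical_iso (phi psi : {rmorphism R -> R}) (I : finType) (g : I -> R) :
  cancel phi psi ->
  is_radical (ideal_gen (phi \o g)) -> is_radical (ideal_gen g).
Proof.
move=> phiK rad f n [a aE].
have [|b bE] := rad (phi f) n.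
  exists (phi \o a); rewrite -rmorphXn aE rmorph_sum; apply: eq_bigr => i _.
  by rewrite rmorphM.
exists (psi \o b); rewrite -[f]phiK bE rmorph_sum; apply: eq_bigr => i _.
by rewrite rmorphM /= phiK.
Qed.

Lemma crs_crs w y x c :
  crs (crs w y) x c = y c * dot w x - w c * dot y x.
Proof. by rewrite /dot !(sum_I3 _ c) /crs !I3_addE; ring. Qed.

(** Exactness of the Koszul complex of a regular sequence of length 3, in the
    degree where the differential is the cross product with [x]. *)
Lemma koszul_exact x (c : 'I_3) :
  (forall h, ideal2 (x (c + 1)) (x (c + 2%:R)) (x c * h) ->
     ideal2 (x (c + 1)) (x (c + 2%:R)) h) ->
  (forall h g, x (c + 1) * h = x (c + 2%:R) * g ->
     exists k, h = x (c + 2%:R) * k) ->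
  (forall h, x (c + 2%:R) * h = 0 -> h = 0) ->
  forall d, dot d x = 0 -> exists e, d =1 crs x e.
Proof.
move=> nzd0 nzd1 nzd2 d; rewrite /dot (sum_I3 _ c) => dx0.
have [a [b d0E]] : ideal2 (x (c + 1)) (x (c + 2%:R)) (d c).
  apply: nzd0; exists (- d (c + 1)), (- d (c + 2%:R)).
  by apply/eqP; rewrite -subr_eq0 -dx0; apply/eqP; ring.
have [k kE] : exists k, a * x c + d (c + 1) = x (c + 2%:R) * k.
  apply: (nzd1 _ (- (b * x c + d (c + 2%:R)))).
  by apply/eqP; rewrite -subr_eq0 -dx0 d0E; apply/eqP; ring.
have d2E : d (c + 2%:R) = - (x (c + 1) * k) - b * x c.
  apply/eqP; rewrite -subr_eq0; apply/eqP/nzd2.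
  rewrite [RHS](_ : _ = d c * x c + d (c + 1) * x (c + 1)
     + d (c + 2%:R) * x (c + 2%:R)
     + x (c + 1) * (x (c + 2%:R) * k - (a * x c + d (c + 1)))); last first.
    by rewrite dx0 kE; ring.
  by rewrite d0E; ring.
have d1E : d (c + 1) = x (c + 2%:R) * k - a * x c by rewrite -kE; ring.
exists (fun i => if i == c + 2%:R then a else if i == c + 1 then - b else k).
have neq2 : (c + 1 == c + 2%:R) = false by case: (c) => [[|[|[|?]]] ?].
have neq0 : ((c == c + 2%:R) = false) * ((c == c + 1) = false).
  by case: (c) => [[|[|[|?]]] ?].
move=> i; rewrite /crs; case: (I3_case c i) => ->; rewrite ?I3_addE.
all: rewrite ?eqxx ?neq2 ?neq0 ?d0E ?d1E ?d2E; ring.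
Qed.

(** With u = w x y, the last two hypotheses make [ideal_gen (crs u x)] the
    intersection of [ideal_gen u] and [ideal2 (dot w x) (dot y x)], so it is radical
    along with them. *)
Lemma crs_radical_step w y x (c : 'I_3) :
  is_radical (ideal_gen (crs w y)) ->
  is_radical (ideal2 (dot w x) (dot y x)) ->
  (forall h, ideal2 (dot w x) (dot y x) (crs w y c * h) ->
     ideal2 (dot w x) (dot y x) h) ->
  (forall d, dot d x = 0 -> exists e, d =1 crs x e) ->
  is_radical (ideal_gen (crs (crs w y) x)).
Proof.
set u := crs w y; set p := dot w x; set q := dot y x.
move=> radu radQ nzd kos f n fnI.
have [a fE] : ideal_gen u f.
  apply: (radu f n); move: fnI; apply: ideal_gen_incl.
    exact: ideal_gen_ideal.
  move=> i; have [_ JD JM] := ideal_gen_ideal u.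
  rewrite /crs mulrC -mulNr [- _ * _]mulrC mulrN -mulNr.
  by apply: JD; apply: JM; apply: mem_ideal_gen.
(* (w x y) x x = (w.x) y - (y.x) w, so (u x x) is contained in (p, q). *)
have [a' [b' fE']] : ideal2 p q f.
  apply: (radQ f n); move: fnI; apply: ideal_gen_incl.
    exact: ideal2_ideal.
  by move=> i; rewrite crs_crs; exists (y i), (- w i); rewrite mulNr.
(* u_c (a.x) = x_c f + a.(u_c x - x_c u), where f is in (p, q) and the entries of
   u_c x - x_c u are, up to sign, components of u x x. *)
have [al [be axE]] : ideal2 p q (dot a x).
  apply: nzd.
  exists (x c * a' + a (c + 1) * y (c + 2%:R) - a (c + 2%:R) * y (c + 1)).
  exists (x c * b' - a (c + 1) * w (c + 2%:R) + a (c + 2%:R) * w (c + 1)).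
  transitivity (x c * (a' * p + b' * q)
     + a (c + 1) * (y (c + 2%:R) * p - w (c + 2%:R) * q)
     - a (c + 2%:R) * (y (c + 1) * p - w (c + 1) * q)); last by ring.
  rewrite -fE' fE -!crs_crs -/u /dot !(sum_I3 _ c) /crs !I3_addE; ring.
have [e eE] : exists e, (fun i => a i - al * w i - be * y i) =1 crs x e.
  apply: kos; transitivity (dot a x - al * p - be * q).
    by rewrite /p /q /dot !(sum_I3 _ c); ring.
  by rewrite axE; ring.
exists e; rewrite fE.
have aE i : a i = crs x e i + al * w i + be * y i by rewrite -eE; ring.
rewrite !(sum_I3 _ c) !aE /u /crs !I3_addE; ring.
Qed.

End CrossAlgebra.

(** * Leading monomials and ideals with two generators *)

Section LeadingMonomials.
Variables (F : fieldType) (n : nat).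
Local Notation R := {mpoly F[n]}.
Implicit Types (f g h p q u : R) (m : 'X_{1..n}).

Definition coprimem m1 m2 := forall t, m1 t = 0%N \/ m2 t = 0%N.

Definition squarefreem m := forall t, (m t <= 1)%N.

Lemma mpolyX_neq0 m : 'X_[m] != 0 :> R.
Proof. by rewrite -mleadc_eq0 mleadXm mcoeffX eqxx oner_eq0. Qed.

Lemma dvd_mleadM m f g : f != 0 -> g != 0 ->
  (m <= mlead f)%MM -> (m <= mlead (f * g))%MM.
Proof.
move=> f0 g0 le; rewrite mleadM //; apply/mnm_lepP => t.
by rewrite mnmDE (leq_trans (mnm_lepP le t)) ?leq_addr.
Qed.

(** One step of polynomial division. *)
Lemma lead_cancel f g : f != 0 -> g != 0 -> (mlead g <= mlead f)%MM ->
  exists c, f - c * g = 0 \/ (mlead (f - c * g) < mlead f)%O.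
Proof.
move=> f0 g0 le.
pose k := mleadc f / mleadc g.
exists (k *: 'X_[mlead f - mlead g]).
have k0 : k != 0 by rewrite mulf_neq0 ?invr_eq0 ?mleadc_eq0.
set h := _ * g.
have X0 : k *: 'X_[mlead f - mlead g] != 0 :> R.
  by rewrite scaler_eq0 negb_or k0 mpolyX_neq0.
have lX : mlead (k *: 'X_[mlead f - mlead g] : R) = (mlead f - mlead g)%MM.
  by rewrite mleadZ // mleadXm.
have lh : mlead h = mlead f by rewrite /h mleadM // lX submK.
have hc : h@_(mlead f) = mleadc f.
  have -> : mlead f = (mlead (k *: 'X_[mlead f - mlead g] : R) + mlead g)%MM.
    by rewrite lX submK.
  rewrite mleadcM lX mcoeffZ mcoeffX eqxx mulr1 submK //.
  by rewrite /k divfK ?mleadc_eq0.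
have [->|fh0] := eqVneq (f - h) 0; [by left|right].
have : (mlead (f - h) <= mlead f)%O.
  by apply: le_trans (mleadB_le _ _) _; rewrite lh joinxx.
rewrite le_eqVlt => /orP[/eqP E|//].
by move: fh0; rewrite -mleadc_eq0 E mcoeffB hc subrr eqxx.
Qed.

(** If every leading monomial of [T] is one of [J], then [T] is contained in [J],
    by division.  Here [T] may be the set of all f for which a power, or a multiple
    by a fixed polynomial, is in [J], or the kernel of a substitution. *)
Lemma lead_ideal_incl (J T : R -> Prop) : ideal J ->
  (forall f g, T f -> J g -> T (f - g)) ->
  (forall f, T f -> f != 0 ->
     exists2 g, J g & g != 0 /\ (mlead g <= mlead f)%MM) ->
  forall f, T f -> J f.
Proof.
case=> J0 JD JM TB Tlead; elim/mleadrect => f IH Tf.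
have [->//|f0] := eqVneq f 0.
have [g Jg [g0 le]] := Tlead f Tf f0.
have [c cP] := lead_cancel f0 g0 le.
rewrite -[f](subrK (c * g)); apply: JD; last exact: JM.
case: cP => [->//|lt]; apply: IH => //.
by apply: TB => //; apply: JM.
Qed.

(** Two polynomials with coprime leading monomials form a Groebner basis.  If the
    leading terms cancel in a * p + b * q, coprimality makes the leading monomial
    of q divide that of a, and the representation can be changed by a multiple
    of the syzygy (q, - p) so as to lower the leading monomial of a. *)
Lemma ideal2_lead p q f : p != 0 -> q != 0 -> coprimem (mlead p) (mlead q) ->
  ideal2 p q f -> f != 0 ->
  (mlead p <= mlead f)%MM \/ (mlead q <= mlead f)%MM.
Proof.
move=> p0 q0 cop [a [b fE]] f0.
elim/mleadrect: a b fE => a IH b fE.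
have [a0|a0] := eqVneq a 0.
  right; move: f0; rewrite fE a0 mul0r add0r mulf_eq0 negb_or => /andP[b0 _].
  by rewrite mulrC dvd_mleadM // lepm_refl.
have [b0|b0] := eqVneq b 0.
  by left; rewrite fE b0 mul0r addr0 mulrC dvd_mleadM // lepm_refl.
have [E|ne] := eqVneq (mlead (a * p)) (mlead (b * q)); last first.
  rewrite fE mleadD //; case: leP => _; [right|left];
  by rewrite mulrC dvd_mleadM // lepm_refl.
have le : (mlead q <= mlead a)%MM.
  apply/mnm_lepP => t; move/mnmP/(_ t): E; rewrite !mleadM // !mnmDE.
  by case: (cop t) => ->; rewrite ?addn0 => // ->; rewrite leq_addl.
have [c cP] := lead_cancel a0 q0 le.
have fE' : f = (a - c * q) * p + (b + c * p) * q by rewrite fE; ring.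
case: cP => [a'0|lt]; last exact: IH lt _ fE'.
have b'0 : b + c * p != 0.
  by apply: contraNneq f0 => b'0; rewrite fE' a'0 b'0 !mul0r addr0.
by right; rewrite fE' a'0 mul0r add0r mulrC dvd_mleadM // lepm_refl.
Qed.

Lemma mem_ideal2l p q : ideal2 p q p.
Proof. by exists 1, 0; rewrite mul1r mul0r addr0. Qed.

Lemma mem_ideal2r p q : ideal2 p q q.
Proof. by exists 0, 1; rewrite mul1r mul0r add0r. Qed.

Lemma ideal_expB (J : R -> Prop) k f g :
  ideal J -> J (f ^+ k) -> J g -> J ((f - g) ^+ k).
Proof.
case=> _ JD JM Jf Jg.
have -> : (f - g) ^+ k = f ^+ k + - (\sum_(i < k) f ^+ (k.-1 - i) * (f - g) ^+ i) * g.
  have := subrXX f (f - g) k; rewrite opprB addrCA subrr addr0 => E.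
  by rewrite mulNr mulrC -E opprB addrCA subrr addr0.
by apply: JD => //; apply: JM.
Qed.

(** The initial ideal is generated by two squarefree monomials and so is radical;
    if a power of f lies in the ideal, the leading monomial of f lies in the
    initial ideal, and division applies. *)
Lemma ideal2_radical p q : p != 0 -> q != 0 ->
  coprimem (mlead p) (mlead q) ->
  squarefreem (mlead p) -> squarefreem (mlead q) ->
  is_radical (ideal2 p q).
Proof.
move=> p0 q0 cop sp sq f k; move: f; apply: lead_ideal_incl.
- exact: ideal2_ideal.
- by move=> f g Jf Jg; apply: ideal_expB => //; apply: ideal2_ideal.
move=> f Jf f0.
have red m : squarefreem m -> (m <= mlead (f ^+ k))%MM -> (m <= mlead f)%MM.
  move=> sm /mnm_lepP le; apply/mnm_lepP => t; move: (le t) (sm t).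
  rewrite mleadX // mulmnE; case: (mlead f t) => [|x]; last lia.
  by rewrite mul0n.
have [le|le] := ideal2_lead p0 q0 cop Jf (expf_neq0 k f0).
- by exists p; [exact: mem_ideal2l|split=> //; exact: red].
- by exists q; [exact: mem_ideal2r|split=> //; exact: red].
Qed.

(** If the leading monomial of u is a nonzerodivisor modulo the initial ideal,
    then u is one modulo the ideal. *)
Lemma ideal2_nzd p q u : p != 0 -> q != 0 -> u != 0 ->
  coprimem (mlead p) (mlead q) -> coprimem (mlead p) (mlead u) ->
  coprimem (mlead q) (mlead u) ->
  forall h, ideal2 p q (u * h) -> ideal2 p q h.
Proof.
move=> p0 q0 u0 cop cpu cqu; apply: lead_ideal_incl.
- exact: ideal2_ideal.
- move=> f g Jf [a [b ->]]; have [_ JD JM] := ideal2_ideal p q.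
  rewrite mulrBr -mulrN; apply: JD => //; apply: JM.
  by exists (- a), (- b); ring.
move=> f Jf f0.
have red m : coprimem m (mlead u) -> (m <= mlead (u * f))%MM -> (m <= mlead f)%MM.
  move=> cm /mnm_lepP le; apply/mnm_lepP => t; move: (le t).
  by rewrite mleadM // mnmDE; case: (cm t) => ->.
have [le|le] := ideal2_lead p0 q0 cop Jf (mulf_neq0 u0 f0).
- by exists p; [exact: mem_ideal2l|split=> //; exact: red].
- by exists q; [exact: mem_ideal2r|split=> //; exact: red].
Qed.

Lemma lead_coprime_dvd p u : p != 0 -> u != 0 -> coprimem (mlead p) (mlead u) ->
  forall h g, u * h = p * g -> exists k, h = p * k.
Proof.
move=> p0 u0 cop h g E.
pose J f := exists k, f = p * k.
pose T f := exists g, u * f = p * g.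
suff JT : forall f, T f -> J f by apply: JT; exists g.
apply: lead_ideal_incl.
- split; first by exists 0; rewrite mulr0.
    by move=> _ _ [k ->] [l ->]; exists (k + l); rewrite mulrDr.
  by move=> c _ [k ->]; exists (c * k); rewrite mulrCA.
- move=> f _ [k kE] [l ->]; exists (k - u * l); rewrite mulrBr kE; ring.
move=> f [k kE] f0; exists p; first by exists 1; rewrite mulr1.
split=> //; have k0 : k != 0.
  by apply: contraTneq (mulf_neq0 u0 f0) => k0; rewrite kE k0 mulr0 eqxx.
apply/mnm_lepP => t; have /mnmP/(_ t) := congr1 (@mlead _ _) kE.
rewrite !mleadM // !mnmDE; case: (cop t) => -> //.
by rewrite add0n => ->; rewrite leq_addr.
Qed.

End LeadingMonomials.

(** * Leading monomials of iterated cross products *)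

Section CrossLeads.
Variables (F : fieldType) (n : nat).
Local Notation R := {mpoly F[n]}.
Implicit Types (e f : 'I_3 -> 'I_n) (a w : 'I_3 -> R) (c : 'I_3).

Definition vars e : 'I_3 -> R := fun c => 'X_(e c).

Definition vanish_upto (K : nat) (m : 'X_{1..n}) :=
  forall t : 'I_n, (t <= K)%N -> m t = 0%N.

(** Variables of smaller index are larger, so between monomials of the same
    degree the first variable that occurs decides. *)
Lemma lt_first_var (m1 m2 : 'X_{1..n}) (i j : 'I_n) : mdeg m1 = mdeg m2 ->
  vanish_upto i m1 -> vanish_upto i m2 -> (i < j)%N ->
  ((m1 + U_(j))%MM < (m2 + U_(i))%MM)%O.
Proof.
move=> d z1 z2 ij; apply/ltmcP; first by rewrite !mdegD d !mdeg1.
exists i => [t ti|]; rewrite !mnmDE !mnm1E.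
  rewrite z1 ?z2 ?(ltnW ti) //.
  rewrite -!val_eqE /= (gtn_eqF ti) gtn_eqF //; exact: ltn_trans ij.
by rewrite z1 ?z2 // eqxx -val_eqE /= gtn_eqF.
Qed.

Lemma mleadMX (p : R) i : p != 0 -> mlead (p * 'X_i) = (mlead p + U_(i))%MM.
Proof. by move=> p0; rewrite mleadM ?mpolyX_neq0 // mleadXm. Qed.

Lemma mlead_add_lt (p q : R) : p != 0 -> (mlead q < mlead p)%O ->
  p + q != 0 /\ mlead (p + q) = mlead p.
Proof.
move=> p0 lt; split; last exact: mleadDl.
apply: contraTneq lt => /eqP; rewrite addr_eq0 => /eqP ->.
by rewrite mleadN ltxx.
Qed.

Lemma mlead_sub_first_var (p q : R) (i j : 'I_n) : p != 0 -> q != 0 ->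
  mdeg (mlead p) = mdeg (mlead q) ->
  vanish_upto i (mlead p) -> vanish_upto i (mlead q) -> (i < j)%N ->
  p * 'X_i - q * 'X_j != 0
  /\ mlead (p * 'X_i - q * 'X_j) = (mlead p + U_(i))%MM.
Proof.
move=> p0 q0 d zp zq ij; rewrite -mleadMX //.
apply: mlead_add_lt; first by rewrite mulf_neq0 ?mpolyX_neq0.
by rewrite mleadN !mleadMX //; apply: lt_first_var.
Qed.

(** The order inside a block of three variables; [c] is the position of the
    largest variable, that is, the one of smallest index. *)
Definition pat_lt e (c : 'I_3) := (e c < e (c + 2%:R)%R < e (c + 1)%R)%N.

Lemma pat_lt_min e c i : pat_lt e c -> (e c <= e i)%N.
Proof. by rewrite /pat_lt => /andP[? ?]; case: (I3_case c i) => ->; lia. Qed.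

Lemma pat_lt_max e c i : pat_lt e c -> (e i <= e (c + 1)%R)%N.
Proof. by rewrite /pat_lt => /andP[? ?]; case: (I3_case c i) => ->; lia. Qed.

(** Each component of the cross product has two terms, which contain different
    new variables; those come before all variables of [a] and decide. *)
Lemma mlead_crs a e c d : pat_lt e c -> (forall i, a i != 0) ->
  (forall i, mdeg (mlead (a i)) = d) ->
  (forall i, vanish_upto (e (c + 1)%R) (mlead (a i))) ->
  [/\ forall i, crs a (vars e) i != 0,
      mlead (crs a (vars e) c) = (mlead (a (c + 1)%R) + U_(e (c + 2%:R)%R))%MM,
      mlead (crs a (vars e) (c + 1)%R) = (mlead (a (c + 2%:R)%R) + U_(e c))%MM
    & mlead (crs a (vars e) (c + 2%:R)%R) = (mlead (a (c + 1)%R) + U_(e c))%MM].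
Proof.
move=> pat a0 da za; have /andP[lt1 lt2] := pat.
have z i j : vanish_upto (e j) (mlead (a i)).
  by move=> t te; apply: za; apply: leq_trans te (pat_lt_max _ pat).
have [n0 E0] := mlead_sub_first_var (a0 (c + 1)) (a0 (c + 2%:R))
  (etrans (da _) (esym (da _))) (z _ _) (z _ _) lt2.
have [n1 E1] := mlead_sub_first_var (a0 (c + 2%:R)) (a0 c)
  (etrans (da _) (esym (da _))) (z _ _) (z _ _) lt1.
have [n2 E2] := mlead_sub_first_var (a0 (c + 1)) (a0 c)
  (etrans (da _) (esym (da _))) (z _ _) (z _ _) (ltn_trans lt1 lt2).
have crs2 : crs a (vars e) (c + 2%:R)
    = - (a (c + 1) * 'X_(e c) - a c * 'X_(e (c + 1))).
  by rewrite /crs /vars !I3_addE opprB.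
split=> [i|||]; last by rewrite crs2 mleadN.
- case: (I3_case c i) => ->; last by rewrite crs2 oppr_eq0.
    by rewrite /crs.
  by rewrite /crs !I3_addE.
- by rewrite /crs.
- by rewrite /crs !I3_addE.
Qed.

Lemma mlead_dot a e c d : (forall i, i != c -> (e c < e i)%N) ->
  (forall i, a i != 0) ->
  (forall i, mdeg (mlead (a i)) = d) ->
  (forall i, vanish_upto (e c) (mlead (a i))) ->
  dot a (vars e) != 0 /\ mlead (dot a (vars e)) = (mlead (a c) + U_(e c))%MM.
Proof.
move=> lt a0 da za; have [lt1 lt2] : (e c < e (c + 1)%R)%N /\ (e c < e (c + 2%:R)%R)%N.
  by split; apply: lt; case: (c) => [[|[|[|?]]] ?].
rewrite /dot (sum_I3 _ c) /vars -[in X in _ /\ X]mleadMX // -addrA.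
apply: mlead_add_lt; first by rewrite mulf_neq0 ?mpolyX_neq0.
apply: (le_lt_trans (mleadD_le _ _)).
by rewrite ltUx !mleadMX //; apply/andP; split; apply: lt_first_var; rewrite ?da.
Qed.

Lemma coprimem_sym (m1 m2 : 'X_{1..n}) : coprimem m1 m2 -> coprimem m2 m1.
Proof. by move=> c t; case: (c t); [right|left]. Qed.

Lemma coprimemU i (m : 'X_{1..n}) : m i = 0%N -> coprimem U_(i)%MM m.
Proof. by move=> mi t; rewrite mnm1E; case: eqP => [<-|]; [right|left]. Qed.

Lemma coprimemD (m1 m2 m : 'X_{1..n}) :
  coprimem m1 m -> coprimem m2 m -> coprimem (m1 + m2)%MM m.
Proof.
move=> c1 c2 t; rewrite mnmDE; have [|->] := c1 t; last by right.
by have [->|->] := c2 t => [->|_]; [left|right].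
Qed.

Lemma squarefreeDU (m : 'X_{1..n}) i :
  squarefreem m -> m i = 0%N -> squarefreem (m + U_(i))%MM.
Proof.
by move=> sm mi t; rewrite mnmDE mnm1E; case: eqP => [<-|_]; rewrite ?mi ?addn0.
Qed.

(** The invariant of the recursion.  In general only two components have coprime
    leading monomials, and the pair rotates by one step with each cross product:
    this is what forces the order inside the blocks to rotate. *)
Record lead_shape a (K : nat) (c : 'I_3) (d : nat) : Prop := LeadShape {
  shape_neq0 : forall i, a i != 0;
  shape_deg : forall i, mdeg (mlead (a i)) = d;
  shape_low : forall i (t : 'I_n), (t < K)%N -> mlead (a i) t = 0%N;
  shape_sqf : forall i, squarefreem (mlead (a i));
  shape_cop : coprimem (mlead (a c)) (mlead (a (c + 1)))
}.

Lemma lead_shape_vars e c : pat_lt e c -> lead_shape (vars e) (e c) c 1.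
Proof.
move=> pat; split; rewrite /vars => *; rewrite ?mpolyX_neq0 ?mleadXm ?mdeg1 //.
- rewrite mnm1E -val_eqE gtn_eqF //=.
  by apply: leq_trans (pat_lt_min _ pat).
- by move=> t; rewrite mnm1E leq_b1.
- apply: coprimemU; rewrite mnm1E -val_eqE gtn_eqF //=.
  by case/andP: pat => ? ?; lia.
Qed.

(** The new leading monomials are m (c + 1) e (c + 2) and m (c + 2) e c at the
    indices c and c + 1, where m stands for the leading monomials of [a]; they
    inherit coprimality from the pair (c + 1, c + 2) of [a]. *)
Lemma lead_shape_crs a e K c d : pat_lt e c -> (e (c + 1)%R < K)%N ->
  lead_shape a K (c + 1) d -> lead_shape (crs a (vars e)) (e c) c d.+1.
Proof.
move=> pat ltK [a0 da za sa copa]; have /andP[lt1 lt2] := pat.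
have zK i j : mlead (a i) (e j) = 0%N.
  by apply: za; apply: leq_ltn_trans (pat_lt_max _ pat) ltK.
have [|n0 E0 E1 E2] := mlead_crs pat a0 da.
  by move=> i t te; apply: za; apply: leq_ltn_trans te ltK.
have low i (t : 'I_n) j : (t < e c)%N -> (mlead (a i) + U_(e j))%MM t = 0%N.
  move=> te; rewrite mnmDE mnm1E -val_eqE gtn_eqF ?za ?addn0 //=; last first.
    exact: leq_trans te (pat_lt_min _ pat).
  by apply: ltn_trans te _; apply: ltn_trans ltK; lia.
split=> // [i|i t te|i|].
- by case: (I3_case c i) => ->; rewrite ?E0 ?E1 ?E2 mdegD da mdeg1 addn1.
- by case: (I3_case c i) => ->; rewrite ?E0 ?E1 ?E2 low.
- case: (I3_case c i) => ->; rewrite ?E0 ?E1 ?E2; exact: squarefreeDU.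
rewrite E0 E1 /=; apply: coprimemD; apply: coprimem_sym; apply: coprimemD.
- by apply: coprimem_sym; move: copa; rewrite !I3_addE.
- exact: coprimemU.
- by apply: coprimem_sym; apply: coprimemU.
- by apply: coprimemU; rewrite mnm1E -val_eqE gtn_eqF.
Qed.

Lemma koszul_vars f : injective f ->
  forall d, dot d (vars f) = 0 -> exists b, d =1 crs (vars f) b.
Proof.
move=> injf; pose c : 'I_3 := 0.
have cop i j : i != j -> coprimem (mlead (vars f i)) (mlead (vars f j)).
  move=> ij; rewrite /vars !mleadXm; apply: coprimemU; rewrite mnm1E.
  by rewrite (inj_eq injf) eq_sym (negPf ij).
have X0 i : vars f i != 0 by apply: mpolyX_neq0.
apply: (@koszul_exact _ _ c).
- by apply: ideal2_nzd => //; apply: cop.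
- by apply: lead_coprime_dvd => //; apply: cop.
- by move=> h /eqP; rewrite mulf_eq0 (negPf (X0 _)) => /eqP.
Qed.

(** With the block [e] first and the block [f] second, the leading monomials of
    p = w.x, q = y.x and u_c are m (c + 2) f (c + 2), e c f c and
    m (c + 1) e (c + 2), where m stands for the leading monomials of [w]. *)
Lemma crs_radical_ordered w e f K c d :
  lead_shape w K (c + 1) d -> pat_lt e c -> pat_lt f (c + 2%:R) ->
  (e (c + 1)%R < f (c + 2%:R)%R)%N -> (f c < K)%N ->
  is_radical (ideal_gen (crs w (vars e))) ->
  is_radical (ideal_gen (crs (crs w (vars e)) (vars f))).
Proof.
move=> [w0 dw zw sw copw] pe pf ef fK rad.
have /andP[e1 e2] := pe; have := pf; rewrite /pat_lt !I3_addE => /andP[f1 f2].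
have neq i j : (e i < f j)%N.
  by case: (I3_case c i) => ->; case: (I3_case c j) => ->; lia.
have wf i j : mlead (w i) (f j) = 0%N.
  by apply: zw; apply: leq_ltn_trans fK; case: (I3_case c j) => ->; lia.
have we i j : mlead (w i) (e j) = 0%N.
  by apply: zw; apply: ltn_trans fK; apply: neq.
have injf : injective f.
  move=> i j /(congr1 (@nat_of_ord n)); case: (I3_case c i) => ->;
  case: (I3_case c j) => -> //; lia.
have [p0 pE] : dot w (vars f) != 0 /\
    mlead (dot w (vars f)) = (mlead (w (c + 2%:R)%R) + U_(f (c + 2%:R)%R))%MM.
  apply: (mlead_dot (d := d)) => // i; last first.
    by move=> t tf; apply: zw; apply: leq_ltn_trans fK; lia.
  by case: (I3_case c i) => ->; rewrite ?eqxx // => _; lia.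
have [q0 qE] : dot (vars e) (vars f) != 0 /\
    mlead (dot (vars e) (vars f)) = (U_(e c) + U_(f c))%MM.
  have -> : dot (vars e) (vars f) = dot (vars f) (vars e).
    by rewrite /dot; apply: eq_bigr => i _; rewrite mulrC.
  rewrite addmC; have -> : U_(f c)%MM = mlead (vars f c) by rewrite /vars mleadXm.
  apply: (mlead_dot (d := 1)) => [i|i|i|i].
  - by case: (I3_case c i) => ->; rewrite ?eqxx // => _; lia.
  - exact: mpolyX_neq0.
  - by rewrite /vars mleadXm mdeg1.
  - move=> t te; rewrite /vars mleadXm mnm1E -val_eqE gtn_eqF //=.
    by apply: leq_ltn_trans te (neq _ _).
have [|u0 uE _ _] := mlead_crs pe w0 dw.
  by move=> i t te; apply: zw; apply: ltn_trans fK; apply: leq_ltn_trans te (neq _ _).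
have Ue i j : i != j -> U_(e i)%MM (e j) = 0%N.
  move=> ij; rewrite mnm1E; apply/eqP; rewrite eqb0; apply: contra ij => /eqP /(congr1 (@nat_of_ord n)).
  case: (I3_case c i) => ->; case: (I3_case c j) => -> //; lia.
have Uf i j : i != j -> U_(f i)%MM (f j) = 0%N.
  by move=> ij; rewrite mnm1E (inj_eq injf) (negPf ij).
have Uef i j : U_(e i)%MM (f j) = 0%N.
  by rewrite mnm1E -val_eqE ltn_eqF //=.
have Ufe i j : U_(f i)%MM (e j) = 0%N.
  by rewrite mnm1E -val_eqE gtn_eqF //=.
have [c01 c02 c12] : [/\ c != c + 1, c != c + 2%:R & c + 1 != c + 2%:R].
  by case: (c) => [[|[|[|?]]] ?].
have cop_pq : coprimem (mlead (dot w (vars f))) (mlead (dot (vars e) (vars f))).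
  rewrite pE qE; apply: coprimem_sym; apply: coprimemD;
  by apply: coprimemU; rewrite mnmDE ?we ?wf ?Ufe ?Uf // eq_sym.
apply: (crs_radical_step (c := c) rad _ _ (koszul_vars injf)).
  apply: ideal2_radical => //.
    by rewrite pE; apply: squarefreeDU.
  rewrite qE; apply: squarefreeDU; last exact: Uef.
  by move=> t; rewrite mnm1E leq_b1.
apply: ideal2_nzd => //.
- rewrite pE uE; apply: coprimemD; apply: coprimem_sym; apply: coprimemD.
  + by move: copw; rewrite !I3_addE.
  + exact: coprimemU.
  + by apply: coprimem_sym; apply: coprimemU.
  + exact: coprimemU.
- rewrite qE uE; apply: coprimemD; apply: coprimemU;
  by rewrite mnmDE ?we ?wf ?Uef ?Ue // eq_sym.
Qed.

End CrossLeads.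

(** * The minors of a generic matrix with two rows *)

Section GenericMinors.
Variables (F : fieldType) (n : nat).
Local Notation R := {mpoly F[n]}.
Variables (e f : 'I_3 -> 'I_n) (c : 'I_3).
Hypotheses (inje : injective e) (injf : injective f).
Hypothesis (pat : pat_lt e c) (lt_ef : forall i j, (e i < f j)%N).

(** The monomial substituted for a variable: x_i becomes u_i x_c, where u and x are
    the vectors of variables numbered by [e] and [f].  Matrices with rows u and
    u x_c are the generic matrices of rank 1, so the kernel of the substitution
    is the vanishing ideal of the matrices of rank at most 1. *)
Definition param_var (t : 'I_n) : 'X_{1..n} :=
  (if [pick i | f i == t] is Some i then U_(e i) + U_(f c) else U_(t))%MM.

Definition param : {rmorphism R -> R} :=
  mmap (@mpolyC n F) (fun t => 'X_[param_var t]).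

Definition param_mnm (m : 'X_{1..n}) : 'X_{1..n} := (\sum_t param_var t *+ m t)%MM.

Lemma param_var_f i : param_var (f i) = (U_(e i) + U_(f c))%MM.
Proof.
rewrite /param_var; case: pickP => [j /eqP /injf -> //|/(_ i)].
by rewrite eqxx.
Qed.

Lemma param_var_id t : (forall i, f i != t) -> param_var t = U_(t)%MM.
Proof.
by move=> ft; rewrite /param_var; case: pickP => // i; rewrite (negPf (ft i)).
Qed.

Lemma sum_delta (m : 'X_{1..n}) s : (\sum_t (t == s) * m t)%N = m s.
Proof.
rewrite (bigD1 s) //= eqxx mul1n big1 ?addn0 // => t /negPf ->.
by rewrite mul0n.
Qed.

Lemma neq_ef i j : e i != f j.
Proof. by rewrite -val_eqE /= ltn_eqF. Qed.

Lemma neq_fe i j : f i != e j.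
Proof. by rewrite eq_sym neq_ef. Qed.

Lemma param_mnm_e m i : param_mnm m (e i) = (m (e i) + m (f i))%N.
Proof.
rewrite /param_mnm mnm_sumE -(sum_delta m (e i)) -(sum_delta m (f i)) -big_split /=.
apply: eq_bigr => t _; rewrite mulmnE -mulnDl; congr (_ * _)%N.
have [j /eqP <-|ft] := pickP (fun j => f j == t).
  rewrite param_var_f mnmDE !mnm1E (inj_eq inje) (inj_eq injf).
  by rewrite !(negPf (neq_fe _ _)) addn0.
have ft' j : f j != t by rewrite ft.
by rewrite param_var_id // mnm1E [t == f i]eq_sym (ft i) addn0.
Qed.

Lemma param_mnm_f m : param_mnm m (f c) = (m (f c) + m (f (c + 1)%R) + m (f (c + 2%:R)%R))%N.
Proof.
rewrite /param_mnm mnm_sumE -(sum_delta m (f c)) -(sum_delta m (f (c + 1)))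
  -(sum_delta m (f (c + 2%:R))) -!big_split /=.
apply: eq_bigr => t _; rewrite mulmnE -!mulnDl; congr (_ * _)%N.
have [j /eqP <-|ft] := pickP (fun j => f j == t).
  rewrite param_var_f mnmDE !mnm1E !(inj_eq injf) (negPf (neq_ef _ _)) eqxx.
  by case: (c) j => [[|[|[|?]]] ?] [[|[|[|?]]] ?].
have ft' j : f j != t by rewrite ft.
by rewrite param_var_id // mnm1E ![t == f _]eq_sym !ft.
Qed.

Lemma param_mnm_id m t : (forall i, e i != t) -> (forall i, f i != t) -> param_mnm m t = m t.
Proof.
move=> et ft; rewrite /param_mnm mnm_sumE -(sum_delta m t).
apply: eq_bigr => s _; rewrite mulmnE; congr (_ * _)%N.
have [j /eqP <-|fs] := pickP (fun j => f j == s).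
  by rewrite param_var_f mnmDE !mnm1E (negPf (et _)) !(negPf (ft _)).
by rewrite param_var_id ?mnm1E // => i; rewrite fs.
Qed.

Lemma mdeg_param_mnm m :
  mdeg (param_mnm m) = (mdeg m + (m (f c) + m (f (c + 1)%R) + m (f (c + 2%:R)%R)))%N.
Proof.
rewrite /param_mnm mdeg_sum mdegE -(sum_delta m (f c)) -(sum_delta m (f (c + 1)))
  -(sum_delta m (f (c + 2%:R))) -!big_split /=.
apply: eq_bigr => t _; rewrite mdegMn -!mulnDl -mulSn.
congr (_ * _)%N.
have [j /eqP <-|ft] := pickP (fun j => f j == t).
  rewrite param_var_f mdegD !mdeg1 !(inj_eq injf).
  by case: (c) j => [[|[|[|?]]] ?] [[|[|[|?]]] ?].
have ft' j : f j != t by rewrite ft.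
by rewrite param_var_id // mdeg1 ![t == f _]eq_sym !ft.
Qed.

Lemma paramE p : param p = \sum_(m <- msupp p) p@_m *: 'X_[param_mnm m].
Proof.
rewrite /param /= /mmap; apply: eq_bigr => m _; rewrite mul_mpolyC; congr (_ *: _).
by rewrite /mmap1 mprodXnE.
Qed.

(** A monomial divisible by none of the leading monomials u_i x_k of the minors has
    its x-part concentrated as early as its u-part allows, so it is the smallest
    monomial in its fibre under the substitution. *)
Lemma param_mnm_standard_min (m m' : 'X_{1..n}) :
  (m (e c) = 0 \/ m (f (c + 1)%R) = 0 /\ m (f (c + 2%:R)%R) = 0)%N ->
  (m (e (c + 2%:R)%R) = 0 \/ m (f (c + 1)%R) = 0)%N ->
  param_mnm m' = param_mnm m -> (m' <= m)%O -> m' = m.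
Proof.
move=> st1 st2 E le; have /andP[e1 e2] := pat.
have Ee i : (m' (e i) + m' (f i) = m (e i) + m (f i))%N by rewrite -!param_mnm_e E.
have Ef : (m' (f c) + m' (f (c + 1)%R) + m' (f (c + 2%:R)%R)
    = m (f c) + m (f (c + 1)%R) + m (f (c + 2%:R)%R))%N by rewrite -!param_mnm_f E.
have Ed : mdeg m' = mdeg m.
  have := congr1 (@mdeg n) E; rewrite !mdeg_param_mnm; lia.
have Eid t : (forall i, e i != t) -> (forall i, f i != t) -> m' t = m t.
  by move=> et ft; rewrite -(param_mnm_id m et ft) -E param_mnm_id.
have below s (t : 'I_n) : (t < e s)%N -> (forall i, (e i < e s)%N -> m' (e i) = m (e i)) ->
    m' t = m t.
  move=> ts eq; have [i /eqP eit|et] := pickP (fun i => e i == t).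
    by rewrite -eit eq // eit.
  apply: Eid => i; first by rewrite et.
  by rewrite -val_eqE /= gtn_eqF // (ltn_trans ts).
have nlt s : (forall i, (e i < e s)%N -> m' (e i) = m (e i)) -> (m' (e s) <= m (e s))%N.
  move=> eq; rewrite leqNgt; apply/negP => lt.
  move: le; rewrite leNgt => /negP; apply; apply/ltmcP => //.
  by exists (e s) => // t ts; rewrite (below s).
have E0 := Ee c; have E1 := Ee (c + 2%:R); have E2 := Ee (c + 1).
have le0 : (m' (e c) <= m (e c))%N.
  by apply: nlt => i; have := pat_lt_min i pat; lia.
have eq0 : m' (e c) = m (e c) by lia.
have le1 : (m' (e (c + 2%:R)%R) <= m (e (c + 2%:R)%R))%N.
  by apply: nlt => i; case: (I3_case c i) => -> //; lia.
have eq1 : m' (e (c + 2%:R)%R) = m (e (c + 2%:R)%R) by lia.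
apply/mnmP => t.
have [i /eqP <-|et] := pickP (fun i => e i == t).
  by case: (I3_case c i) => -> //; lia.
have [i /eqP <-|ft] := pickP (fun i => f i == t).
  by case: (I3_case c i) => ->; lia.
by apply: Eid => i; rewrite ?et ?ft.
Qed.

(** If f is killed by the substitution, its leading monomial cannot be alone in its
    fibre, so it is not the smallest monomial there and is divisible by the
    leading monomial of a minor.  Hence the minors generate the kernel, which is
    prime. *)
Lemma crs_vars_radical : is_radical (ideal_gen (crs (vars F e) (vars F f))).
Proof.
set J := ideal_gen _; move=> p k.
have param0 q : J q -> param q = 0.
  apply: (ideal_gen_incl (J := fun q => param q = 0)).
    split=> [|a b a0 b0|a b b0]; first exact: rmorph0.
      by rewrite rmorphD a0 b0 addr0.
    by rewrite rmorphM b0 mulr0.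
  move=> i; rewrite /crs /vars rmorphB !rmorphM /= !mmapX !mmap1U.
  rewrite !param_var_f !param_var_id; last 2 first.
  - by move=> j; rewrite neq_fe.
  - by move=> j; rewrite neq_fe.
  rewrite !mpolyXD; ring.
have JT : forall q, param q = 0 -> J q; last first.
  move=> /param0; rewrite rmorphXn => /eqP.
  by rewrite expf_eq0 => /andP[_ /eqP /JT].
have [||n0 l0 l1 l2] := @mlead_crs F n (vars F f) e c 1 pat (fun i => mpolyX_neq0 _ _).
- by move=> i; rewrite /vars mleadXm mdeg1.
- move=> i t te; rewrite /vars mleadXm mnm1E -val_eqE gtn_eqF //=.
  exact: leq_ltn_trans te (lt_ef _ _).
have crsN i : crs (vars F e) (vars F f) i = - crs (vars F f) (vars F e) i.
  by rewrite /crs; ring.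
have Jcrs i : J (crs (vars F f) (vars F e) i).
  have [_ _ JM] := ideal_gen_ideal (crs (vars F e) (vars F f)).
  rewrite -[crs _ _ _]opprK -crsN -mulN1r; apply: JM.
  exact: mem_ideal_gen.
apply: lead_ideal_incl; first exact: ideal_gen_ideal.
  by move=> a b a0 /param0 b0; rewrite rmorphB a0 b0 subrr.
move=> q q0 nz; set m := mlead q.
have dvd i s t : s != t -> mlead (crs (vars F f) (vars F e) i) = (U_(s) + U_(t))%MM ->
    (0 < m s)%N -> (0 < m t)%N ->
    exists2 g, J g & g != 0 /\ (mlead g <= m)%MM.
  move=> st lE ms mt; exists (crs (vars F f) (vars F e) i) => //.
  split=> //; rewrite lE; apply/mnm_lepP => r; rewrite mnmDE !mnm1E.
  have [srE|_] := eqVneq s r; last by case: eqP => // <-.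
  by rewrite -srE [t == s]eq_sym (negPf st).
have fe := neq_fe.
rewrite !/vars !mleadXm in l0 l1 l2.
have [ms1|ms1] := boolP ((0 < m (e c)) && (0 < m (f (c + 1)%R)))%N.
  by case/andP: ms1 => *; apply: dvd (fe _ _) l2 _ _.
have [ms2|ms2] := boolP ((0 < m (e c)) && (0 < m (f (c + 2%:R)%R)))%N.
  by case/andP: ms2 => *; apply: dvd (fe _ _) l1 _ _.
have [ms3|ms3] := boolP ((0 < m (e (c + 2%:R)%R)) && (0 < m (f (c + 1)%R)))%N.
  by case/andP: ms3 => *; apply: dvd (fe _ _) l0 _ _.
have : (param q)@_(param_mnm m) = q@_m.
  rewrite paramE raddf_sum /= (bigD1_seq m) ?msupp_uniq ?mlead_supp //=.
  rewrite mcoeffZ mcoeffX eqxx mulr1 big_seq_cond big1 ?addr0 // => m'.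
  case/andP=> /msupp_le_mlead le ne; rewrite mcoeffZ mcoeffX.
  case: eqP => [E|_]; last by rewrite mulr0.
  case/eqP: ne; apply: param_mnm_standard_min E le; lia.
by rewrite q0 mcoeff0 => /esym/eqP; rewrite mleadc_eq0 (negPf nz).
Qed.

End GenericMinors.

(** * The choice of the order *)

Fixpoint crs_iter (R : comNzRingType) (t : nat -> 'I_3 -> R) (j : nat) :=
  if j is j'.+1 then crs (crs_iter t j') (t j) else t 0%N.

Section IteratedCross.
Variable R : comNzRingType.

Lemma rmorph_crs_iter (phi : {rmorphism R -> R}) (t : nat -> 'I_3 -> R) j c :
  phi (crs_iter t j c) = crs_iter (fun i d => phi (t i d)) j c.
Proof.
elim: j c => [|j IH] c //=.
by rewrite /crs rmorphB !rmorphM /= !IH.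
Qed.

Lemma eq_crs_iter (t t' : nat -> 'I_3 -> R) j :
  (forall i c, (i <= j)%N -> t i c = t' i c) -> crs_iter t j =1 crs_iter t' j.
Proof.
elim: j => [|j IH] tt' c /=; first exact: tt'.
by rewrite /crs !IH ?tt' // => i d ij; apply: tt'; apply: leqW.
Qed.
End IteratedCross.

(** The monomial order is the standard one, so a prescribed order of the variables
    is obtained by renumbering them. *)
Lemma perm_of_priority n (r : 'I_n -> nat) :
  exists s : 'S_n, forall t u, (r t < r u)%N -> (s t < s u)%N.
Proof.
pose r' (t : 'I_n) := (r t * n + t)%N.
have r'_inj : injective r'.
  move=> t u /(congr1 (fun x => x %% n)%N).
  by rewrite !modnMDl !modn_small // => /val_inj.
pose rk (t : 'I_n) := #|[set u | (r' u < r' t)%N]|.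
have rk_lt t u : (r' t < r' u)%N -> (rk t < rk u)%N.
  move=> tu; apply: proper_card; apply/properP; split.
    by apply/subsetP => v; rewrite !inE => /ltn_trans; apply.
  by exists t; rewrite !inE ?ltnn.
have rk_n t : (rk t < n)%N.
  rewrite -[X in (_ < X)%N]card_ord -cardsT; apply: proper_card.
  by apply/properP; split; [exact: subsetT|exists t; rewrite !inE ?ltnn].
have s_inj : injective (fun t => Ordinal (rk_n t)).
  move=> t u /(congr1 val) /= E; apply: r'_inj.
  by case: (ltngtP (r' t) (r' u)) => // /rk_lt; rewrite E ltnn.
exists (perm s_inj) => t u rtu; rewrite !permE /=; apply: rk_lt.
rewrite /r'; apply: (@leq_trans ((r t).+1 * n)).
  by rewrite mulSn addnC ltn_add2r.
by apply: leq_trans (leq_addr _ _); rewrite leq_mul2r rtu orbT.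
Qed.

(** Block [j - 1] comes first, then block [j], then the blocks [j - 2], [j - 3],
    ..., [0]. *)
Definition block (j i : nat) : nat :=
  (if i == j then 1 else if i.+1 == j then 0 else j - i)%N.

(** 2 * (i + c) is 0, 1, 2 modulo 3 for c = - i, - i + 2, - i + 1: the order inside
    the blocks rotates as the invariant [lead_shape] requires. *)
Definition position (j i : nat) (c : 'I_3) : nat :=
  (3 * block j i + (2 * (i + c)) %% 3)%N.

Definition well_ordered n (xi : nat -> 'I_3 -> 'I_n) (j : nat) :=
  forall i i' c c', (i <= j)%N -> (i' <= j)%N ->
    (position j i c < position j i' c')%N -> (xi i c < xi i' c')%N.

Definition top (i : nat) : 'I_3 := inord ((2 * i) %% 3).

Lemma addI3E (c : 'I_3) : (nat_of_ord (c + 1)%R = (c + 1) %% 3)%N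
  * (nat_of_ord (c + 2%:R)%R = (c + 2) %% 3)%N.
Proof. by []. Qed.

Lemma topE i : nat_of_ord (top i) = ((2 * i) %% 3)%N.
Proof. by rewrite /top inordK // ltn_mod. Qed.

Lemma topS i : top i.+1 = top i + 2%:R.
Proof. apply/val_inj; rewrite /= -/(nat_of_ord _) !topE; lia. Qed.

Section Ordered.
Variables (F : fieldType) (n : nat) (xi : nat -> 'I_3 -> 'I_n) (j : nat).
Hypothesis ord : well_ordered xi j.
Local Notation X := (fun i => vars F (xi i)).

Lemma pat_lt_level i : (i <= j)%N -> pat_lt (xi i) (top i).
Proof.
move=> ij; apply/andP; split; apply: ord => //;
rewrite /position ltn_add2l !addI3E topE; lia.
Qed.

Lemma block_lt i i' c c' : (i <= j)%N -> (i' <= j)%N ->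
  (block j i < block j i')%N -> (xi i c < xi i' c')%N.
Proof. by move=> ij ij' lt; apply: ord => //; rewrite /position; lia. Qed.

Lemma lead_shape_level i : (i < j)%N ->
  lead_shape (crs_iter X i) (xi i (top i)) (top i) i.+1.
Proof.
elim: i => [|i IH] ij; first exact/lead_shape_vars/pat_lt_level.
apply: (lead_shape_crs (K := xi i (top i))).
- exact: pat_lt_level (ltnW ij).
- by apply: block_lt => //; rewrite /block; do ?case: eqP; lia.
- by rewrite topS !I3_addE; apply: IH; apply: ltnW.
Qed.

Lemma pat_lt_inj (e : 'I_3 -> 'I_n) c : pat_lt e c -> injective e.
Proof.
case/andP=> e1 e2 i k /(congr1 (@nat_of_ord n)).
case: (I3_case c i) => ->; case: (I3_case c k) => -> //; lia.
Qed.

End Ordered.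

Lemma crs_iter_radical_base (F : fieldType) n (xi : nat -> 'I_3 -> 'I_n) :
  well_ordered xi 1 ->
  is_radical (ideal_gen (crs_iter (fun i => vars F (xi i)) 1)).
Proof.
move=> ord; have pat0 := pat_lt_level ord (leq0n 1).
apply: (crs_vars_radical (pat_lt_inj pat0) _ pat0) => [|i k].
  exact: pat_lt_inj (pat_lt_level ord (leqnn 1)).
exact: (block_lt ord).
Qed.

Lemma crs_iter_radical_step (F : fieldType) n (xi : nat -> 'I_3 -> 'I_n) j :
  let X i := vars F (xi i) in
  well_ordered xi j.+2 ->
  is_radical (ideal_gen (crs_iter X j.+1)) ->
  is_radical (ideal_gen (crs_iter X j.+2)).
Proof.
move=> X ord rad.
apply: (@crs_radical_ordered _ _ _ _ _ (xi j (top j)) (top j.+1) j.+1) => //.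
- by rewrite topS !I3_addE; apply: (lead_shape_level F ord).
- exact: (pat_lt_level ord).
- by rewrite -topS; apply: (pat_lt_level ord).
- by apply: (block_lt ord) => //; rewrite /block; do ?case: eqP; lia.
- by apply: (block_lt ord) => //; rewrite /block; do ?case: eqP; lia.
Qed.

Definition inj_levels n (xi : nat -> 'I_3 -> 'I_n) (j : nat) :=
  forall i i' c c', (i <= j)%N -> (i' <= j)%N ->
    xi i c = xi i' c' -> i = i' /\ c = c'.

Lemma well_ordered_renumbering n (xi : nat -> 'I_3 -> 'I_n) j :
  inj_levels xi j ->
  exists s : 'S_n, well_ordered (fun i c => s (xi i c)) j.
Proof.
move=> inj.
pose r (t : 'I_n) :=
  if [pick ic : 'I_j.+1 * 'I_3 | xi ic.1 ic.2 == t] is Some ic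
  then position j ic.1 ic.2 else 0%N.
have rE i c : (i <= j)%N -> r (xi i c) = position j i c.
  move=> ij; rewrite /r; case: pickP => [[i' c'] /= /eqP E|/(_ (inord i, c))].
    have ij' : (i' <= j)%N by rewrite -ltnS.
    by have [-> ->] := inj _ _ _ _ ij' ij E.
  by rewrite /= inordK ?eqxx.
have [s sP] := perm_of_priority r.
by exists s => i i' c c' ij ij' lt; apply: sP; rewrite !rE.
Qed.

Lemma msym_var (F : fieldType) n (s : 'S_n) i :
  msym s 'X_i = 'X_(s i) :> {mpoly F[n]}.
Proof.
rewrite msymX; congr 'X_[_]; apply/mnmP => t; rewrite mnmE !mnm1E.
by rewrite -(inj_eq (@perm_inj _ s)) permKV.
Qed.

(** The numbering is arbitrary because the good order changes with [j]: the
    induction hypothesis is applied to the numbering chosen for [j.+2]. *)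
Lemma crs_iter_radical (F : fieldType) n (xi : nat -> 'I_3 -> 'I_n) j :
  inj_levels xi j.+1 ->
  is_radical (ideal_gen (crs_iter (fun i => vars F (xi i)) j.+1)).
Proof.
elim: j xi => [|j IH] xi inj; have [s ord] := well_ordered_renumbering inj.
all: have sK : cancel (msym s : {rmorphism {mpoly F[n]} -> {mpoly F[n]}})
  (msym s^-1 : {rmorphism {mpoly F[n]} -> {mpoly F[n]}})
  by move=> p /=; rewrite -msymMm mulgV msym1m.
all: apply: (is_radical_iso sK).
all: apply: (is_radical_eq (g := crs_iter (fun i => vars F (fun c => s (xi i c))) _)) => [c|].
1,3: by rewrite /comp rmorph_crs_iter; apply: eq_crs_iter => i d _;
  rewrite /vars /= msym_var.
  exact: crs_iter_radical_base.
apply: (crs_iter_radical_step ord); apply: (IH (fun i c => s (xi i c))).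
move=> i i' c c' ij ij' /perm_inj; apply: inj; exact: leqW.
Qed.

(** * Removing the matrix S *)

Section Signs.
Variables (F : fieldType) (n : nat) (b : 'I_n -> bool).
Local Notation R := {mpoly F[n]}.

Definition sign_aut : {rmorphism R -> R} :=
  mmap (@mpolyC n F) (fun t => (-1) ^+ b t * 'X_t).

Lemma sign_aut_var t : sign_aut 'X_t = (-1) ^+ b t * 'X_t.
Proof. by rewrite /sign_aut /= mmapX mmap1U. Qed.

Lemma sign_rmorphK (phi : {rmorphism R -> R}) :
  (forall a, phi a%:MP = a%:MP) ->
  (forall t, phi 'X_t = (-1) ^+ b t * 'X_t) -> involutive phi.
Proof.
move=> phiC phiX p; suff H : phi (phi (\sum_(m <- msupp p) p@_m *: 'X_[m]))
    = \sum_(m <- msupp p) p@_m *: 'X_[m] by rewrite -mpolyE in H.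
rewrite !rmorph_sum; apply: eq_bigr => m _.
rewrite -mul_mpolyC !rmorphM !phiC; congr (_ * _).
rewrite mpolyXE_id !rmorph_prod; apply: eq_bigr => t _.
rewrite !rmorphXn; congr (_ ^+ _).
by rewrite phiX rmorphM rmorph_sign phiX signrMK.
Qed.

Lemma sign_autK : involutive sign_aut.
Proof.
apply: sign_rmorphK sign_aut_var => a; exact: mmapC.
Qed.
End Signs.

Lemma cross_crs (R : comNzRingType) (a b : 'cV[R]_3) c :
  cross a b c 0 = crs (a ^~ 0) (b ^~ 0) c.
Proof.
rewrite /cross mxE /crs.
by case: c => [[|[|[|c]]] Hc] //=; congr (_ * _ - _ * _);
  congr (fun_of_matrix _ _ _); apply/val_inj; rewrite /= inordK.
Qed.

Lemma Smx_mulE (R : comNzRingType) (a : 'cV[R]_3) c :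
  (Smx R *m a) c 0 = (-1) ^+ (c < 2)%N * a c 0.
Proof.
rewrite /Smx mul_diag_mx !mxE.
by case: c => [[|[|[|c]]] Hc].
Qed.

(** S is a rotation of order 2, so S (a x b) = S a x S b, and the factors S can be
    moved onto the variables and, an even or odd number of times, outside. *)
Lemma wvec_crs_iter (R : comNzRingType) (v : nat -> 'cV[R]_3) i c :
  wvec v i.+2 c 0 = (-1) ^+ (odd i && (c < 2)%N) *
    crs_iter (fun l d => (-1) ^+ [&& (0 < l)%N, ~~ odd l & (d < 2)%N] * v l.+1 d 0)
      i.+1 c.
Proof.
elim: i c => [|i IH] c.
  by rewrite /= cross_crs /crs /= !mul1r.
have -> : wvec v i.+3 = cross (Smx R *m wvec v i.+2) (v i.+3) by [].
rewrite cross_crs [crs_iter _ _]/= -/(crs_iter _ i.+1) /crs !Smx_mulE !IH.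
rewrite /= negbK.
case: (odd i); case: c => [[|[|[|c]]] Hc] //=; rewrite ?expr0 ?expr1; ring.
Qed.

Theorem theorem42 (F : fieldType) (charF : 2%N \notin [pchar F])
    (k : nat) (hk : (2 <= k)%N) : is_radical (Ik F k).
Proof.
case: k hk => [|[|j]] // _.
pose xi i (c : 'I_3) := mxvec_index (inord i : 'I_j.+2) c.
have injxi : inj_levels xi j.+1.
  move=> i i' c c' ij ij' E; have [g gK _] := curry_mxvec_bij j.+2 3.
  have := congr1 g E; rewrite /xi (gK (_, _)) // (gK (_, _)) // => -[/(congr1 val)].
  by rewrite /= !inordK.
(* sb l d: whether S ^ (l + 1) changes the sign of component d; the vector of
   index 0 carries no factor S. *)
pose sb l (d : 'I_3) := [&& (0 < l)%N, ~~ odd l & (d < 2)%N].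
pose b t := [exists l : 'I_j.+2, [exists d, (xi l d == t) && sb l d]].
have bE i c : (i <= j.+1)%N -> b (xi i c) = sb i c.
  move=> ij; apply/idP/idP => [/existsP[l /existsP[d /andP[/eqP E]]]|si].
    have lj : (l <= j.+1)%N by rewrite -ltnS.
    by have [-> ->] := injxi _ _ _ _ lj ij E.
  by apply/existsP; exists (inord i); apply/existsP; exists c; rewrite inordK // eqxx.
rewrite /Ik; apply: is_radical_signed => [c|]; first exact: wvec_crs_iter.
apply: (is_radical_iso (sign_autK b)).
apply: (is_radical_eq (g := crs_iter (fun i => vars F (xi i)) j.+1)); last first.
  exact: crs_iter_radical.
move=> c.
rewrite [RHS]rmorph_crs_iter; apply: eq_crs_iter => i d ij.
rewrite rmorphM rmorph_sign /vvec mxE /=.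
have -> : insub i = Some (inord i : 'I_j.+2).
  by rewrite insubT //; congr Some; apply/val_inj; rewrite /= inordK.
by rewrite -/(xi i d) sign_aut_var bE // signrMK.
Qed.
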